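(* Let $\xi$ be a real-valued random variable with zero mean and finite positive variance, and assume that the moment generating function $M_\xi(t)=\mathbb{E}(e^{t\xi})$ exists (is finite) in an open interval around zero. Let $\{\xi_k : k\ge 0\}$ be a sequence of independent identically distributed random variables with $\xi_k$ equal in distribution to $\xi$ for every $k\ge 0$. Let $\phi:[0,1]\to\mathbb{R}$ be a non-zero (i.e. not identically zero) continuous function, and for $n\ge 1$ let $$W_n(x)=\sum_{j=0}^{n-1}\xi_j\,\phi(j/n)\,e^{ijx},\qquad x\in\mathbb{T}.$$ Then there are positive constants $C_0$ and $C_1$, depending only on the moment generating function of $\xi$ and the function $\phi$, such that for all sufficiently large $n$ $$\mathbb{P}\left(\|W_n\|_\infty\ \ge\ C_0\Big((\log n)\sum_{j=0}^{n-1}|\phi(j/n)|^2\Big)^{1/2}\right)\ \le\ \frac{C_1}{n^2}.$$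
   Context: $\mathbb{T}=\mathbb{R}/(2\pi\mathbb{Z})$. For a bounded function $f:\mathbb{T}\to\mathbb{C}$, $\|f\|_\infty=\sup_{x\in\mathbb{T}}|f(x)|$, where $|\cdot|$ is the complex modulus. $i$ is the imaginary unit (in $e^{ijx}$). *)

(* Defs.v *)
Set Warnings "-notation-overridden,-notation-incompatible-prefix".
From HB Require Import structures.
From mathcomp Require Import all_boot all_order all_algebra finmap.
From mathcomp Require Import complex.
From mathcomp Require Import all_classical all_reals all_analysis.

Set Implicit Arguments.
Unset Strict Implicit.
Unset Printing Implicit Defensive.

Import Order.TTheory GRing.Theory Num.Theory.
Import numFieldNormedType.Exports.

Local Open Scope classical_set_scope.
Local Open Scope ring_scope.
Local Open Scope complex_scope.

(* Preimages of nonmeasurable sets carry no information (a measure of the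
   library is unconstrained there), hence the restrictions to measurable sets
   in the next two definitions. *)
Definition mutually_independent d d' (T : measurableType d)
    (T' : measurableType d') (R : realType) (P : probability T R) (I : choiceType)
    (X : I -> {RV P >-> T'}) : Prop :=
  forall (J : {fset I}) (B : I -> set T'), (forall j, measurable (B j)) ->
    P (\bigcap_(j in [set` J]) (X j @^-1` B j)) =
    (\prod_(j <- J) P (X j @^-1` B j))%E.

Definition equal_in_distribution d1 d2 d' (T1 : measurableType d1)
    (T2 : measurableType d2) (T' : measurableType d') (R : realType)
    (P1 : probability T1 R) (P2 : probability T2 R)
    (X1 : {RV P1 >-> T'}) (X2 : {RV P2 >-> T'}) : Prop :=
  forall A : set T', measurable A ->
    distribution P1 X1 A = distribution P2 X2 A.

Definition expi (R : realType) (t : R) : R[i] := cos t +i* sin t.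

(* A function on the circle R/(2 pi Z) is represented by its 2 pi-periodic lift
   to the line, so the supremum over the circle is the one over the line. *)
Definition supnorm (R : realType) (f : R -> R[i]) : R :=
  sup (range (fun x => Normc.normc (f x))).

Definition random_trig_poly (R : realType) (T : Type) (xi : nat -> T -> R)
    (phi : R -> R) (n : nat) (w : T) (x : R) : R[i] :=
  \sum_(j < n) (xi j w * phi (j%:R / n%:R))%:C * expi (j%:R * x).

Lemma random_trig_poly_periodic (R : realType) (T : Type) (xi : nat -> T -> R)
    (phi : R -> R) (n : nat) (w : T) :
  periodic (random_trig_poly xi phi n w) (pi *+ 2).
Proof.
move=> x; apply: eq_bigr => j _; congr (_ * _).
have -> : j%:R * (x + pi *+ 2) = j%:R * x + pi *+ 2 *+ j :> R.
  by rewrite mulrDr [_ * (pi *+ 2)]mulr_natl.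
by congr (_ +i* _); [apply: (periodicn (@cosD2pi R))|apply: (periodicn (@sinD2pi R))].
Qed.

(* Main.v *)
(* Chernoff plus a net.  Since [E xi = 0] and [M] is finite at [-dl] and [dl],
   [M t <= exp (K t^2)] for [|t| <= dl / 2], with [K] depending on [M] only.
   By independence, a real sum [S = sum_(j < n) a_j X_j] with
   [|a_j| <= |phi (j / n)|] then satisfies
   [P (|S| >= lam) <= 2 exp (K t^2 A - t lam)] when [t |a_j| <= dl / 2], where
   [A = sum_(j < n) |phi (j / n)|^2] grows linearly in [n] because [phi] is
   continuous and nonzero.  The choice [t = sqrt (ln n / A)] and
   [lam = (K + 6) sqrt (A ln n)] makes this bound [2 n^-6].  It is applied to
   the real and imaginary parts of [W_n] at the [n^4] points [2 pi k / n^4];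
   between these points [W_n] moves by [O(1 / n)] as soon as [|X_j| < n] for
   all [j < n], which fails with probability [O(n exp (- dl n))]. *)

Require Import Defs.
Set Warnings "-notation-overridden,-notation-incompatible-prefix".
From HB Require Import structures.
From mathcomp Require Import all_boot all_order all_algebra finmap.
From mathcomp Require Import complex.
From mathcomp Require Import all_classical all_reals all_analysis.
From mathcomp Require Import measurable_realfun ring lra.

Set Implicit Arguments.
Unset Strict Implicit.
Unset Printing Implicit Defensive.

Import Order.TTheory GRing.Theory Num.Theory.
Import numFieldNormedType.Exports.

Local Open Scope classical_set_scope.
Local Open Scope ring_scope.

Section independence.
Local Open Scope ereal_scope.
Context d (T : measurableType d) (R : realType) (Q : probability T R).

Import HBNNSimple.

Lemma ge0_integralM_indep d' (T' : measurableType d') (F : T -> R)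
    (Y : {RV Q >-> T'}) (g : T' -> R) :
  measurable_fun setT F -> (forall w, 0 <= F w)%R ->
  measurable_fun setT g -> (forall y, 0 <= g y)%R ->
  \int[Q]_w (F w)%:E \is a fin_num ->
  (forall B, measurable B -> \int[Q]_w (F w * \1_B (Y w))%:E =
     \int[Q]_w (F w)%:E * Q (Y @^-1` B)) ->
  \int[Q]_w (F w * g (Y w))%:E = \int[Q]_w (F w)%:E * \int[Q]_w (g (Y w))%:E.
Proof.
move=> mF F0 mg g0 Ffin FY.
have mY : measurable_fun setT Y by exact: measurable_funP.
have mEg : measurable_fun setT (EFin \o g) by exact/measurable_EFinP.
pose f := nnsfun_approx measurableT mEg.
have fcvg y : (f n y)%:E @[n --> \oo] --> (g y)%:E.
  have /cvg_lim : EFin \o f ^~ y @ \oo --> (EFin \o g) y.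
    by apply: cvg_nnsfun_approx => // t _; rewrite lee_fin.
  by move=> _; apply: cvg_nnsfun_approx => // t _; rewrite lee_fin.
have mfY n : measurable_fun setT (fun w => f n (Y w)).
  by apply: measurableT_comp => //; exact: measurable_funP.
have f0 n y : (0 <= f n y)%R by [].
have fnd y m n : (m <= n)%N -> (f m y <= f n y)%R.
  by move=> mn; exact/lefP/nd_nnsfun_approx.
have FfY n : \int[Q]_w (F w * f n (Y w))%:E =
    \int[Q]_w (F w)%:E * \int[Q]_w (f n (Y w))%:E.
  have mfp k : measurable (f n @^-1` [set k]) by exact: measurable_funPTI.
  have m1 k : measurable_fun setT (fun w => \1_(f n @^-1` [set k]) (Y w) : R).
    by apply: measurableT_comp => //; exact: measurable_indic.
  have pos k y : (0 <= k * \1_(f n @^-1` [set k]) y)%R.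
    by have := nnfun_muleindic_ge0 (f n) k y; rewrite -EFinM lee_fin.
  transitivity (\sum_(k \in range (f n)) \int[Q]_w (F w * (k *
      \1_(f n @^-1` [set k]) (Y w)))%:E).
    under eq_integral do rewrite fimfunE mulr_fsumr -fsumEFin//.
    rewrite ge0_integral_fsum//.
    - move=> k; apply/measurable_EFinP/measurable_funM => //.
      exact: measurable_funM.
    - by move=> k w _; rewrite lee_fin mulr_ge0.
  transitivity (\sum_(k \in range (f n)) \int[Q]_w (F w)%:E *
      \int[Q]_w (k * \1_(f n @^-1` [set k]) (Y w))%:E); last first.
    rewrite -ge0_mule_fsumr//; last first.
      by move=> k; apply: integral_ge0 => w _; rewrite lee_fin.
    rewrite -ge0_integral_fsum//.
    - congr (_ * _); apply: eq_integral => w _.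
      by rewrite [in RHS]fimfunE -fsumEFin.
    - by move=> k; exact/measurable_EFinP/measurable_funM.
    - by move=> k w _; rewrite lee_fin.
  apply: eq_fsbigr => k; rewrite inE/= => -[y _ fyk].
  have k0 : (0 <= k)%R by rewrite -fyk.
  have ind : \int[Q]_w (\1_(f n @^-1` [set k]) (Y w))%:E =
      Q (Y @^-1` (f n @^-1` [set k])).
    transitivity (\int[Q]_w (\1_(Y @^-1` (f n @^-1` [set k])) w)%:E).
      by apply: eq_integral => w _; rewrite !indicE.
    by rewrite integral_indic// ?setIT// -[X in measurable X]setTI; exact: mY.
  under eq_integral do rewrite mulrCA EFinM.
  rewrite ge0_integralZl_EFin//; last 2 first.
  - by move=> w _; rewrite lee_fin mulr_ge0.
  - exact/measurable_EFinP/measurable_funM.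
  have -> : \int[Q]_w (k * \1_(f n @^-1` [set k]) (Y w))%:E =
      k%:E * \int[Q]_w (\1_(f n @^-1` [set k]) (Y w))%:E.
    under eq_integral do rewrite EFinM.
    by rewrite ge0_integralZl_EFin//; exact/measurable_EFinP.
  by rewrite FY// ind muleCA.
transitivity (limn (fun n => \int[Q]_w (F w * f n (Y w))%:E)).
  rewrite -monotone_convergence//.
  - apply: eq_integral => w _; apply/esym/cvg_lim => //.
    under eq_fun do rewrite EFinM.
    by rewrite EFinM; apply: cvgeZl => //; exact: fcvg.
  - by move=> n; exact/measurable_EFinP/measurable_funM.
  - by move=> n w _; rewrite lee_fin mulr_ge0.
  - by move=> w _ m n mn; rewrite lee_fin ler_wpM2l// fnd.
under eq_fun do rewrite FfY.
have fint : (fun n => \int[Q]_w (f n (Y w))%:E) @ \oo -->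
    \int[Q]_w (g (Y w))%:E.
  rewrite (_ : \int[Q]_w (g (Y w))%:E =
      \int[Q]_w limn (fun n => (f n (Y w))%:E)); last first.
    by apply: eq_integral => w _; apply/esym/cvg_lim => //; exact: fcvg.
  apply: cvg_monotone_convergence => //.
  - by move=> n; exact/measurable_EFinP.
  - by move=> n w _; rewrite lee_fin.
  - by move=> w _ m n mn; rewrite lee_fin fnd.
by apply/cvg_lim => //; exact: cvgeZl.
Qed.

Lemma integral_prod_mutually_independent d' (T' : measurableType d')
    (X : nat -> {RV Q >-> T'}) (g : nat -> T' -> R) (n : nat) :
  mutually_independent X ->
  (forall j, measurable_fun setT (g j)) -> (forall j y, 0 <= g j y)%R ->
  (forall j, (j < n)%N -> \int[Q]_w (g j (X j w))%:E \is a fin_num) ->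
  \int[Q]_w (\prod_(j < n) g j (X j w))%:E =
  \prod_(j < n) \int[Q]_w (g j (X j w))%:E.
Proof.
(* Replace the indicators of arbitrary measurable sets by the [g j] one index
   at a time: [h k B] uses [g j] for [j < k], the indicator of [B j] after. *)
move=> indX mg g0 gfin.
have mX j : measurable_fun setT (X j) by exact: measurable_funP.
pose h k (B : nat -> set T') j : T' -> R :=
  if (j < k)%N then g j else \1_(B j).
have mh k B : (forall j, measurable (B j)) ->
    forall j, measurable_fun setT (h k B j).
  by move=> mB j; rewrite /h; case: ifP => // _; exact: measurable_indic.
have h0 k B j y : (0 <= h k B j y)%R.
  by rewrite /h; case: ifP => // _; rewrite indicE.
have mhX k B : (forall j, measurable (B j)) ->
    forall j, measurable_fun setT (fun w => h k B j (X j w)).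
  by move=> mB j; apply: measurableT_comp => //; exact: mh.
have ind j A : measurable A ->
    \int[Q]_w (\1_A (X j w))%:E = Q (X j @^-1` A).
  move=> mA; transitivity (\int[Q]_w (\1_(X j @^-1` A) w)%:E).
    by apply: eq_integral => w _; rewrite !indicE.
  by rewrite integral_indic// ?setIT// -[X in measurable X]setTI; exact: mX.
have hfin k B (j : 'I_n) : (forall j, measurable (B j)) ->
    \int[Q]_w (h k B j (X j w))%:E \is a fin_num.
  move=> mB; rewrite /h; case: ifP => _; first exact: gfin.
  rewrite ind//.
  by rewrite fin_num_measure// -[X in measurable X]setTI; exact: mX.
suff H k B : (forall j, measurable (B j)) ->
    \int[Q]_w (\prod_(j < n) h k B j (X j w))%:E =
    \prod_(j < n) \int[Q]_w (h k B j (X j w))%:E.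
  have := H n (fun=> setT) (fun=> measurableT).
  under [in LHS]eq_integral do under eq_bigr do rewrite /h ltn_ord.
  move=> ->; apply: eq_bigr => j _; rewrite /h ltn_ord//.
elim: k B => [B mB|k IH B mB].
  pose J : {fset nat} := [fset j in iota 0 n]%fset.
  have Jn j : (j \in J) = (j < n)%N by rewrite !inE/= mem_iota.
  have pJ : perm_eq J (index_iota 0 n).
    apply: uniq_perm => [||j]; first exact: fset_uniq.
      exact: iota_uniq.
    by rewrite Jn mem_index_iota.
  have := indX J B mB; rewrite (perm_big _ pJ)/= big_mkord => prodE.
  under [RHS]eq_bigr do rewrite /h ind//.
  rewrite -prodE; set E := \bigcap_(j in _) _.
  have mE : measurable E.
    apply: bigcap_measurableType => j _.
    by rewrite -[X in measurable X]setTI; exact: mX.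
  rewrite -[E in RHS]setIT -integral_indic//; apply: eq_integral => w _.
  congr _%:E; rewrite indicE; have [wE|wE] := boolP (w \in E).
    apply: big1 => j _; rewrite /h/= indicE mem_set//.
    by move: wE; rewrite inE => /(_ j); apply; rewrite /= Jn.
  have /existsNP[j Bj] : ~ forall j : 'I_n, B j (X j w).
    move=> EB; move/negP: wE; apply; rewrite inE => j /=.
    by rewrite Jn => jn; exact: (EB (Ordinal jn)).
  by rewrite (bigD1 j)//= /h/= indicE memNset// mul0r.
have [nk|kn] := leqP n k.
  have hE (j : 'I_n) : h k.+1 B j = h k B j.
    have jk : (j < k)%N by exact: leq_trans (ltn_ord j) nk.
    by rewrite /h jk ltnS ltnW.
  under eq_integral do under eq_bigr do rewrite hE.
  by rewrite IH//; apply: eq_bigr => j _; rewrite hE.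
pose k' := Ordinal kn.
rewrite (bigD1 k')//=.
have hkE : h k.+1 B k = g k by rewrite /h ltnSn.
pose BA A i := if i == k then A else B i.
have hE A (j : 'I_n) : j != k' ->
    h k (BA A) j = h k.+1 B j.
  move=> jk; have {}jk : (j == k :> nat) = false by apply: contraNF jk.
  by rewrite /h /BA jk ltnS [in RHS]leq_eqVlt jk.
pose F w := (\prod_(j < n | j != k') h k.+1 B j (X j w))%R.
have mF : measurable_fun setT F.
  rewrite /F; under eq_fun do rewrite big_mkcond.
  by apply: measurable_prod => j _ /=; case: (j != k') => //; exact: mhX.
have mBA A : measurable A ->
    forall j, measurable (BA A j).
  by move=> mA j; rewrite /BA; case: ifP.
have hkA A : h k (BA A) k = \1_A by rewrite /h ltnn /BA eqxx.
have FA A : measurable A -> \int[Q]_w (F w * \1_A (X k w))%:E =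
    (\prod_(j < n | j != k') \int[Q]_w (h k.+1 B j (X j w))%:E) *
    Q (X k @^-1` A).
  move=> mA; rewrite -ind// -hkA.
  transitivity (\int[Q]_w (\prod_(j < n) h k (BA A) j (X j w))%:E).
    apply: eq_integral => w _; rewrite (bigD1 k')//= mulrC.
    by congr (_ * _)%:E; apply: eq_bigr => j jk; rewrite hE.
  rewrite IH; last exact: mBA.
  rewrite (bigD1 k')//= muleC; congr (_ * _).
  by apply: eq_bigr => j jk; rewrite hE.
have Fint : \int[Q]_w (F w)%:E =
    \prod_(j < n | j != k') \int[Q]_w (h k.+1 B j (X j w))%:E.
  have := FA setT measurableT; rewrite preimage_setT probability_setT mule1 => <-.
  by apply: eq_integral => w _; rewrite indicT mulr1.
under eq_integral do rewrite (bigD1 k')//= -/(F _) hkE mulrC.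
rewrite ge0_integralM_indep//.
- by rewrite Fint hkE muleC.
- by move=> w; apply: prodr_ge0.
- rewrite Fint; apply: prode_fin_num => j _; exact: hfin.
- by move=> A mA; rewrite FA// Fint.
Qed.
End independence.

Section moment_generating_function.
Context (R : realType).

Lemma expR_le_quadratic (y : R) : expR y <= 1 + y + y ^+ 2 * expR `|y|.
Proof.
have e1 := expR_ge1Dx y.
have e2 := expR_ge1Dx (- y).
have e3 := expRxMexpNx_1 y.
have e4 := expR_gt0 y.
have eN : expR y - 1 <= y * expR y by nra.
have [y0|y0] := leP 0 y.
  by rewrite ger0_norm//; nra.
have : 1 <= expR `|y| by rewrite -expR0 ler_expR normr_ge0.
by nra.
Qed.

Lemma sqr_le_expR (d x : R) : 0 < d ->
  x ^+ 2 <= 16 / d ^+ 2 * expR (d / 2 * `|x|).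
Proof.
move=> d0; rewrite -[x ^+ 2]real_normK ?num_real//; set y := `|x|.
have y0 : 0 <= y by exact: normr_ge0.
have -> : d / 2 * y = d * y / 4 + d * y / 4 by lra.
have := expR_ge1Dx (d * y / 4); rewrite expRD; set e := expR _ => ee.
have h : (d * y / 4) ^+ 2 <= e * e.
  rewrite expr2 ler_pM// ?(le_trans _ ee)// ?ler_wpDl//;
    by rewrite divr_ge0 ?mulr_ge0// ltW.
rewrite mulrAC ler_pdivlMr ?exprn_gt0//.
by move: h; rewrite exprMn exprMn; lra.
Qed.

Lemma norm_le_expR (d x : R) : 0 < d ->
  `|x| <= d^-1 * (expR (d * x) + expR (- d * x)).
Proof.
move=> d0; rewrite ler_pdivlMl//.
have := expR_ge1Dx (d * x); have := expR_ge1Dx (- d * x).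
have := expR_gt0 (d * x); have := expR_gt0 (- d * x).
by case: (ger0P x) => ?; nra.
Qed.

Lemma expR_norm_le (x : R) : expR `|x| <= expR x + expR (- x).
Proof.
have := expR_gt0 x; have := expR_gt0 (- x).
by case: (ger0P x) => ?; lra.
Qed.

Lemma expR_le_quadratic_mgf (d t x : R) : 0 < d -> `|t| <= d / 2 ->
  expR (x * t) <= 1 + t * x +
    16 / d ^+ 2 * t ^+ 2 * (expR (x * d) + expR (x * - d)).
Proof.
move=> d0 td; apply: (le_trans (expR_le_quadratic _)).
rewrite [x * t]mulrC lerD2l exprMn -[leLHS]mulrA.
rewrite [16 / _ * _]mulrC -[leRHS]mulrA.
rewrite ler_wpM2l ?sqr_ge0//.
apply: (@le_trans _ _ (16 / d ^+ 2 * expR (d / 2 * `|x|) * expR `|t * x|)).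
  by rewrite ler_wpM2r ?expR_ge0// sqr_le_expR.
rewrite -!mulrA ler_pM2l// ler_wpM2l ?invr_ge0 ?sqr_ge0//.
rewrite -expRD mulrN; apply: le_trans (expR_norm_le _).
rewrite ler_expR !normrM (gtr0_norm d0).
by have := ler_wpM2r (normr_ge0 x) td; lra.
Qed.

Local Open Scope ereal_scope.

Context d (T : measurableType d) (P : probability T R) (xi : {RV P >-> R}).

Lemma mmt_gen_fun_ge0 t : 0 <= 'M_P xi t.
Proof.
rewrite /mmt_gen_fun unlock; apply: integral_ge0 => w _.
by rewrite lee_fin expR_ge0.
Qed.

Lemma mmt_gen_fun_gauss (dl m t : R) : (0 < dl)%R -> 'E_P[xi] = 0 ->
  'M_P xi dl + 'M_P xi (- dl) = m%:E -> (`|t| <= dl / 2)%R ->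
  'M_P xi t <= (expR (16 / dl ^+ 2 * m * t ^+ 2))%:E.
Proof.
move=> dl0 E0 Mm tdl.
have mxi : measurable_fun setT xi by exact: measurable_funP.
have mexp s : measurable_fun setT (fun w => expR (xi w * s)).
  by apply: measurableT_comp => //; exact: measurable_funM.
have ifin (s : R) : 'M_P xi s < +oo ->
    P.-integrable setT (fun w => (expR (xi w * s))%:E).
  move=> Ms; apply/integrableP; split; first exact/measurable_EFinP.
  move: Ms; rewrite /mmt_gen_fun unlock; apply: le_lt_trans.
  rewrite le_eqVlt; apply/orP; left; apply/eqP.
  by apply: eq_integral => w _; rewrite gee0_abs ?lee_fin ?expR_ge0.
have Mfin : 'M_P xi dl < +oo /\ 'M_P xi (- dl) < +oo.
  have := ltry m; rewrite -Mm.
  have := mmt_gen_fun_ge0 dl; have := mmt_gen_fun_ge0 (- dl).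
  by move: ('M_P xi dl) ('M_P xi (- dl)) => [a||] [b||]//=; rewrite ?ltry.
have [/ifin i1 /ifin i2] := Mfin.
have i12 : P.-integrable setT
    (fun w => (expR (xi w * dl) + expR (xi w * - dl))%:E).
  by under eq_fun do rewrite EFinD; exact: integrableD.
have ixi : P.-integrable setT (EFin \o xi).
  apply: (le_integrable measurableT _ _ (integrableZl measurableT dl^-1 i12)).
    exact/measurable_EFinP.
  move=> w _ /=; rewrite lee_fin.
  apply: (le_trans (norm_le_expR _ dl0)); rewrite mulNr ![(xi w * _)%R]mulrC.
  by rewrite -mulNr ler_norm.
rewrite /mmt_gen_fun unlock.
pose c := (16 / dl ^+ 2 * t ^+ 2)%R.
have i3 : P.-integrable setT (fun w => (1 + t * xi w)%:E).
  under eq_fun do rewrite EFinD EFinM; apply: integrableD => //.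
    exact: finite_measure_integrable_cst.
  exact: integrableZl.
have i4 : P.-integrable setT
    (fun w => c%:E * (expR (xi w * dl) + expR (xi w * - dl))%:E).
  exact: integrableZl.
apply: (@le_trans _ _ (\int[P]_w ((1 + t * xi w)%:E +
    c%:E * (expR (xi w * dl) + expR (xi w * - dl))%:E))).
  apply: ge0_le_integral => //.
  - by move=> w _; rewrite lee_fin expR_ge0.
  - exact/measurable_EFinP/(mexp t).
  - by have /measurable_int := integrableD measurableT i3 i4.
  - move=> w _; rewrite -EFinM -EFinD lee_fin.
    exact: expR_le_quadratic_mgf.
rewrite integralD// integralZl//.
under [X in X + _]eq_integral do rewrite EFinD EFinM.
rewrite integralD//; last 2 first.
- exact: finite_measure_integrable_cst.
- exact: integrableZl.
rewrite integralZl// integral_cst// [X in _ * X + _](probability_setT P) mule1.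
move: E0; rewrite unlock => ->; rewrite mule0 adde0.
under eq_integral do rewrite EFinD.
rewrite integralD//.
move: Mm; rewrite /mmt_gen_fun unlock => ->.
by rewrite -EFinM -EFinD lee_fin (le_trans _ (expR_ge1Dx _))// lerD2l /c mulrAC.
Qed.

Lemma mmt_gen_fun_equal_in_distribution d' (T' : measurableType d')
    (Q : probability T' R) (X : {RV Q >-> R}) t :
  equal_in_distribution X xi -> 'M_Q X t = 'M_P xi t.
Proof.
move=> Xxi.
have mexp : measurable_fun setT (fun y : R => (expR (y * t))%:E).
  by apply/measurable_EFinP/measurableT_comp => //; exact: measurable_funM.
rewrite /mmt_gen_fun unlock.
transitivity (\int[distribution Q X]_y (expR (y * t))%:E).
  by rewrite ge0_integral_distribution// => y; rewrite lee_fin expR_ge0.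
rewrite (eq_measure_integral (distribution P xi)) => [|A mA _]; last exact: Xxi.
by rewrite ge0_integral_distribution// => y; rewrite lee_fin expR_ge0.
Qed.

End moment_generating_function.

Section weighted_sums.
Local Open Scope ereal_scope.
Context d (T : measurableType d) (R : realType) (Q : probability T R).
Variable X : nat -> {RV Q >-> R}.

Definition weighted_sum (a : nat -> R) (n : nat) (w : T) : R :=
  (\sum_(j < n) a j * X j w)%R.

Lemma measurable_weighted_sum a n : measurable_fun setT (weighted_sum a n).
Proof.
by apply: measurable_sum => j; exact: measurable_funM.
Qed.

Lemma chernoff_weighted_sum (K dl : R) (a : nat -> R) n (t lam : R) :
  mutually_independent X ->
  (forall j s, (`|s| <= dl)%R -> 'M_Q (X j) s <= (expR (K * s ^+ 2))%:E) ->
  (0 < t)%R -> (forall j, (j < n)%N -> (t * `|a j| <= dl)%R) ->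
  Q [set w | (lam <= weighted_sum a n w)%R] <=
  (expR (K * (t ^+ 2 * \sum_(j < n) `|a j| ^+ 2) - t * lam))%:E.
Proof.
move=> indX MX t0 ta.
have mS := measurable_weighted_sum a n.
pose S : {RV Q >-> R} :=
  HB.pack (weighted_sum a n) (isMeasurableFun.Build _ _ _ _ _ mS).
apply: (le_trans (chernoff S lam t0)).
rewrite expRD EFinM lee_wpmul2r ?lee_fin ?expR_ge0//.
have aM j : \int[Q]_w (expR (X j w * (a j * t)))%:E = 'M_Q (X j) (a j * t).
  by rewrite /mmt_gen_fun unlock.
have at_le j : (j < n)%N -> (`|a j * t| <= dl)%R.
  by move=> jn; rewrite normrM (gtr0_norm t0) mulrC ta.
have -> : 'M_Q S t = \prod_(j < n) 'M_Q (X j) (a j * t).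
  under eq_bigr do rewrite -aM.
  rewrite -(integral_prod_mutually_independent (g := fun j (y : R) =>
    expR (y * (a j * t)))%R)//.
  - rewrite /mmt_gen_fun unlock; apply: eq_integral => w _ /=.
    rewrite -expR_sum mulr_suml; congr (expR _)%:E.
    by apply: eq_bigr => j _; rewrite mulrAC mulrC mulrA.
  - by move=> j; apply: measurableT_comp => //; exact: measurable_funM.

  - move=> j jn; rewrite aM ge0_fin_numE; last exact: mmt_gen_fun_ge0.
    by apply: le_lt_trans (ltry _); apply: MX; exact: at_le.
rewrite !mulr_sumr expR_sum -prodEFin.
suff [] : 0 <= \prod_(j < n) 'M_Q (X j) (a j * t) /\
  \prod_(j < n) 'M_Q (X j) (a j * t) <=
  \prod_(j < n) (expR (K * (t ^+ 2 * `|a j| ^+ 2)))%:E by [].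
apply: (big_ind2 (fun x y => 0 <= x /\ x <= y)).
- by rewrite lee01.
- by move=> x1 x2 y1 y2 [? ?] [? ?]; rewrite mule_ge0// lee_pmul.
move=> j _; split; first exact: mmt_gen_fun_ge0.
apply: (le_trans (MX _ _ (at_le _ (ltn_ord j)))).
by rewrite lee_fin ler_expR real_normK ?num_real// exprMn [(_ * t ^+ 2)%R]mulrC.
Qed.

Lemma chernoff_norm (dl m y : R) j : (0 < dl)%R ->
  'M_Q (X j) dl + 'M_Q (X j) (- dl) = m%:E ->
  Q [set w | (y <= `|X j w|)%R] <= (m * expR (- (dl * y)))%:E.
Proof.
move=> dl0 Mm.
have mX : measurable_fun setT (X j) by exact: measurable_funP.
have Q1 : Q [set w | (y <= X j w)%R] <=
  'M_Q (X j) dl * (expR (- (dl * y)))%:E by exact: chernoff.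
have mN : measurable_fun setT (fun w => - X j w)%R by exact: measurable_funN.
pose Y : {RV Q >-> R} :=
  HB.pack (fun w => - X j w)%R (isMeasurableFun.Build _ _ _ _ _ mN).
have Q2 : Q [set w | (y <= - X j w)%R] <=
    'M_Q (X j) (- dl) * (expR (- (dl * y)))%:E.
  have := chernoff Y y dl0; rewrite (_ : 'M_Q Y dl = 'M_Q (X j) (- dl))//.
  rewrite /mmt_gen_fun; congr expectation.
  by apply/funext => w /=; rewrite mulNr mulrN.
have mge (f : T -> R) : measurable_fun setT f ->
    measurable [set w | (y <= f w)%R].
  move=> mf; rewrite -[X in measurable X]setTI.
  rewrite (_ : [set _ | _] = f @^-1` `[y, +oo[%classic); first exact: mf.
  by apply/seteqP; split=> w /=; rewrite in_itv/= andbT.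
rewrite (_ : [set _ | _] = [set w | (y <= X j w)%R] `|`
    [set w | (y <= - X j w)%R]).
  apply: (le_trans (measureU2 _ _ _)); [exact: mge|exact: mge|].
  apply: (le_trans (leeD Q1 Q2)).
  by rewrite -ge0_muleDl ?mmt_gen_fun_ge0// Mm.
apply/seteqP; split=> w /=; rewrite ler_normr; first by move/orP.
by move=> h; apply/orP.
Qed.

Lemma chernoff_norm_weighted_sum (K dl : R) (a b : nat -> R) n (t lam : R) :
  mutually_independent X -> (0 <= K)%R ->
  (forall j s, (`|s| <= dl)%R -> 'M_Q (X j) s <= (expR (K * s ^+ 2))%:E) ->
  (0 < t)%R -> (forall j, (j < n)%N -> (`|a j| <= b j)%R) ->
  (forall j, (j < n)%N -> (t * b j <= dl)%R) ->
  Q [set w | (lam <= `|weighted_sum a n w|)%R] <=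
  (2 * expR (K * (t ^+ 2 * \sum_(j < n) b j ^+ 2) - t * lam))%:E.
Proof.
move=> indX K0 MX t0 ab tb.
have one (a' : nat -> R) : (forall j, (j < n)%N -> (`|a' j| <= b j)%R) ->
    Q [set w | (lam <= weighted_sum a' n w)%R] <=
    (expR (K * (t ^+ 2 * \sum_(j < n) b j ^+ 2) - t * lam))%:E.
  move=> a'b; have ta' j : (j < n)%N -> (t * `|a' j| <= dl)%R.
    by move=> jn; apply: le_trans (tb j jn); rewrite ler_pM2l// a'b.
  apply: (le_trans (chernoff_weighted_sum lam indX MX t0 ta')).
  rewrite lee_fin ler_expR lerD2r ler_wpM2l// ler_wpM2l ?sqr_ge0//.
  by apply: ler_sum => j _; rewrite lerXn2r ?nnegrE ?a'b// (le_trans _ (a'b _ _)).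
have mge a' : measurable [set w | (lam <= weighted_sum a' n w)%R].
  rewrite -[X in measurable X]setTI.
  rewrite (_ : [set _ | _] = weighted_sum a' n @^-1` `[lam, +oo[%classic).
    exact: measurable_weighted_sum.
  by apply/seteqP; split=> w /=; rewrite in_itv/= andbT.
pose a' j := (- a j)%R.
have a'E w : weighted_sum a' n w = (- weighted_sum a n w)%R.
  by rewrite /weighted_sum -sumrN; apply: eq_bigr => j _; rewrite mulNr.
rewrite (_ : [set _ | _] = [set w | (lam <= weighted_sum a n w)%R] `|`
    [set w | (lam <= weighted_sum a' n w)%R]).
  apply: (le_trans (measureU2 _ (mge _) (mge _))).
  rewrite [(2 * _)%R]mulr_natl mulr2n EFinD; apply: leeD; first exact: one.
  by apply: one => j jn; rewrite normrN ab.
apply/seteqP; split=> w /=; rewrite ler_normr a'E; first by move/orP.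
by move=> h; apply/orP.
Qed.

End weighted_sums.

Section trigonometric_sums.
Context (R : realType).
Implicit Types (c : nat -> R) (x y : R) (n : nat).

Lemma lipschitz_cos x y : `|cos x - cos y| <= `|x - y|.
Proof.
wlog yx : x y / y <= x.
  by move=> H; case: (leP y x) => [/H//|/ltW/H]; rewrite distrC [leRHS]distrC.
have [z _ ->] : exists2 z, z \in `[y, x] & cos x - cos y = - sin z * (x - y).
  apply: (@MVT_segment R cos (fun z => - sin z)) => //.
  by apply: continuous_subspaceT => z; exact: continuous_cos.
by rewrite normrM normrN ler_piMl// sin_max.
Qed.

Lemma lipschitz_sin x y : `|sin x - sin y| <= `|x - y|.
Proof.
wlog yx : x y / y <= x.
  by move=> H; case: (leP y x) => [/H//|/ltW/H]; rewrite distrC [leRHS]distrC.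
have [z _ ->] : exists2 z, z \in `[y, x] & sin x - sin y = cos z * (x - y).
  apply: (@MVT_segment R sin cos) => //.
  by apply: continuous_subspaceT => z; exact: continuous_sin.
by rewrite normrM ler_piMl// cos_max.
Qed.

Definition cos_sum c n x : R := \sum_(j < n) c j * cos (j%:R * x).
Definition sin_sum c n x : R := \sum_(j < n) c j * sin (j%:R * x).

Lemma lipschitz_trig_sum (f : R -> R) c n x y :
  (forall x y, `|f x - f y| <= `|x - y|) ->
  `|\sum_(j < n) c j * f (j%:R * x) - \sum_(j < n) c j * f (j%:R * y)| <=
  (\sum_(j < n) j%:R * `|c j|) * `|x - y|.
Proof.
move=> lip; rewrite -sumrB mulr_suml.
apply: (le_trans (ler_norm_sum _ _ _)); apply: ler_sum => j _.
rewrite -mulrBr normrM mulrAC mulrC ler_wpM2r//.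
by apply: (le_trans (lip _ _)); rewrite -mulrBr normrM ger0_norm.
Qed.

Lemma lipschitz_cos_sum c n x y :
  `|cos_sum c n x - cos_sum c n y| <=
  (\sum_(j < n) j%:R * `|c j|) * `|x - y|.
Proof. exact: lipschitz_trig_sum lipschitz_cos. Qed.

Lemma lipschitz_sin_sum c n x y :
  `|sin_sum c n x - sin_sum c n y| <=
  (\sum_(j < n) j%:R * `|c j|) * `|x - y|.
Proof. exact: lipschitz_trig_sum lipschitz_sin. Qed.

Lemma periodic_net N x : (0 < N)%N ->
  exists k y, [/\ (k < N)%N, `|y - k%:R / N%:R * (pi *+ 2)| <= pi *+ 2 / N%:R &
    forall (V : zmodType) (g : R -> V), periodic g (pi *+ 2) -> g y = g x].
Proof.
move=> N0; have N0' : 0 < N%:R :> R by rewrite ltr0n.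
have p0 : 0 < pi *+ 2 :> R by rewrite pmulrn_lgt0// pi_gt0.
move: (pi *+ 2) p0 => p p0; pose m := Num.bound `|x / p|.
have xm : 0 <= x + p *+ m.
  have : `|x / p| < m%:R.
    exact: archi_boundP.
  rewrite ltr_norml => /andP[+ _]; rewrite ltr_pdivlMr// => h.
  by rewrite -mulr_natr; nra.
pose u := (x + p *+ m) * N%:R / p.
have u0 : 0 <= u by apply: divr_ge0; [exact: mulr_ge0|exact: ltW].
have /andP[] := truncn_itv u0; set k := Num.truncn u => ku uk.
(* [u] is the position of [x], translated to the positive half line, in units
   of the mesh; quotient and remainder of its floor by [N] give the number of
   turns and the index of the node. *)
exists (k %% N)%N, (x + p *+ m - p *+ (k %/ N)); split.
- exact: ltn_pmod.
- have -> : x + p *+ m - p *+ (k %/ N) -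
      (k %% N)%:R / N%:R * p = (u - k%:R) * (p / N%:R).
    have -> : x + p *+ m = u * p / N%:R.
      by rewrite /u; field; rewrite !lt0r_neq0.
    rewrite [in k%:R](divn_eq k N) natrD natrM -[_ *+ (k %/ N)]mulr_natr.
    by field; rewrite lt0r_neq0.
  have pN0 : 0 <= p / N%:R by rewrite divr_ge0 ?ltW.
  rewrite normrM [X in _ * X]ger0_norm// ler_piMl// ger0_norm ?subr_ge0//.
  by rewrite lerBlDr addrC natr1 ltW.
- move=> V g gp; rewrite -(periodicn gp (k %/ N)) subrK.
  exact: periodicn.
Qed.

Lemma continuous_trig_sum (f : R -> R) c n : continuous f ->
  continuous (fun x => \sum_(j < n) c j * f (j%:R * x)).
Proof.
move=> fc x; elim: n => [|n IH].
  by under eq_fun do rewrite big_ord0; exact: cvg_cst.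
under eq_fun do rewrite big_ord_recr/=.
apply: cvgD; first exact: IH.
apply: cvgMr.
apply: (@continuous_comp _ _ _ (fun x => n%:R * x) f); last exact: fc.
by apply: cvgMr; exact: cvg_id.
Qed.

Lemma normc_random_trig_poly (T : Type) (xi : nat -> T -> R) (phi : R -> R)
    n w x :
  let c j := xi j w * phi (j%:R / n%:R) in
  Normc.normc (random_trig_poly xi phi n w x) =
  Num.sqrt (cos_sum c n x ^+ 2 + sin_sum c n x ^+ 2).
Proof.
move=> c; rewrite (_ : random_trig_poly _ _ _ _ _ =
  (cos_sum c n x +i* sin_sum c n x)%C)//.
rewrite /random_trig_poly /cos_sum /sin_sum -/(c _).
rewrite /expi; elim/big_rec3: _ => // j a b z _ ->.
by simpc.
Qed.

Lemma normc_random_trig_poly_le (T : Type) (xi : nat -> T -> R) (phi : R -> R)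
    n w x :
  let c j := xi j w * phi (j%:R / n%:R) in
  Normc.normc (random_trig_poly xi phi n w x) <=
  `|cos_sum c n x| + `|sin_sum c n x|.
Proof.
rewrite /= normc_random_trig_poly.
set a := cos_sum _ _ _; set b := sin_sum _ _ _.
rewrite -(ger0_norm (addr_ge0 (normr_ge0 a) (normr_ge0 b))) -sqrtr_sqr.
rewrite ler_wsqrtr// sqrrD !real_normK ?num_real// lerD2r lerDl.
by rewrite mulrn_wge0// mulr_ge0.
Qed.

Lemma supnorm_le_net (T : Type) (xi : nat -> T -> R) (phi : R -> R)
    n w N lam L :
  let c j := xi j w * phi (j%:R / n%:R) in
  (0 < N)%N -> \sum_(j < n) j%:R * `|c j| <= L ->
  (forall k, (k < N)%N -> `|cos_sum c n (k%:R / N%:R * (pi *+ 2))| <= lam /\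
                          `|sin_sum c n (k%:R / N%:R * (pi *+ 2))| <= lam) ->
  supnorm (random_trig_poly xi phi n w) <= (lam + L * (pi *+ 2 / N%:R)) *+ 2.
Proof.
move=> c N0 cL net; apply: ge_sup.
  by exists (Normc.normc (random_trig_poly xi phi n w 0)), 0.
move=> _ [x _ <-].
have [k [y [kN yk /(_ _ _ (random_trig_poly_periodic xi phi n w)) <-]]] :=
  periodic_net x N0.
have [ck sk] := net k kN.
apply: (le_trans (normc_random_trig_poly_le _ _ _ _ _)); rewrite mulr2n -/c.
have cLy : (\sum_(j < n) j%:R * `|c j|) * `|y - k%:R / N%:R * (pi *+ 2)| <=
    L * (pi *+ 2 / N%:R).
  by rewrite ler_pM// sumr_ge0// => j _; rewrite mulr_ge0.
have close (a b : R) : `|b| <= lam -> `|a - b| <= L * (pi *+ 2 / N%:R) ->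
    `|a| <= lam + L * (pi *+ 2 / N%:R).
  move=> bl ab; rewrite -[a](subrK b) addrC.
  by apply: (le_trans (ler_normD _ _)); exact: lerD.
rewrite lerD//; [apply: close ck _|apply: close sk _].
  exact: le_trans (lipschitz_cos_sum _ _ _ _) cLy.
exact: le_trans (lipschitz_sin_sum _ _ _ _) cLy.
Qed.

End trigonometric_sums.

Section measurability.
Context d (T : measurableType d) (R : realType).

Lemma measurable_supnorm_ge (xi : nat -> T -> R) (phi : R -> R) n (y : R) :
  (forall j, measurable_fun setT (xi j)) ->
  measurable [set w | y <= supnorm (random_trig_poly xi phi n w)].
Proof.
move=> mxi; pose f w x := Normc.normc (random_trig_poly xi phi n w x).
pose c w j := xi j w * phi (j%:R / n%:R).
have fE w x : f w x =
    Num.sqrt (cos_sum (c w) n x ^+ 2 + sin_sum (c w) n x ^+ 2).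
  exact: normc_random_trig_poly.
have fub w : has_ubound (range (f w)).
  exists (\sum_(j < n) `|c w j| + \sum_(j < n) `|c w j|) => _ [x _ <-].
  apply: (le_trans (normc_random_trig_poly_le _ _ _ _ _)).
  apply: lerD; apply: (le_trans (ler_norm_sum _ _ _)); apply: ler_sum => j _.
    by rewrite normrM ler_piMr// cos_max.
  by rewrite normrM ler_piMr// sin_max.
have fcont w : continuous (f w).
  rewrite (_ : f w = Num.sqrt \o (fun x => cos_sum (c w) n x ^+ 2 +
    sin_sum (c w) n x ^+ 2)); last exact/funext/fE.
  move=> x; apply: continuous_comp; last exact: sqrt_continuous.
  have := @continuous_trig_sum R cos (c w) n (@continuous_cos R) x.
  have := @continuous_trig_sum R sin (c w) n (@continuous_sin R) x.
  by move=> hs hc; apply: cvgD; rewrite /GRing.exp/=; apply: cvgM.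
have mf x : measurable_fun setT (f^~ x).
  rewrite (_ : f^~ x = Num.sqrt \o (fun w => cos_sum (c w) n x ^+ 2 +
    sin_sum (c w) n x ^+ 2)); last by apply/funext => w; exact: fE.
  apply: measurableT_comp.
    by apply: continuous_measurable_fun; exact: sqrt_continuous.
  have mc j : measurable_fun setT (c^~ j) by exact: measurable_funM.
  by apply: measurable_funD; apply: measurable_funX; apply: measurable_sum => j;
    exact: measurable_funM.
(* By continuity the supremum only has to be tested at rational points. *)
rewrite (_ : [set _ | _] = \bigcap_m \bigcup_(q : rat)
    [set w | y - m.+1%:R^-1 < f w (ratr q)]).
  apply: bigcapT_measurable => m; apply: bigcupT_measurable_rat => q.
  rewrite -[X in measurable X]setTI.
  rewrite (_ : [set _ | _] = f^~ (ratr q) @^-1` `]y - m.+1%:R^-1, +oo[%classic).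
    exact: mf.
  by apply/seteqP; split=> w /=; rewrite in_itv/= andbT.
apply/seteqP; split=> w /=.
  move=> yw m _; have ym : y - m.+1%:R^-1 < sup (range (f w)).
    by apply: lt_le_trans yw; rewrite ltrBlDr ltrDl invr_gt0.
  have [|_ [x _ <-] yx] := sup_gt _ ym; first by exists (f w 0), 0.
  have oU : open (f w @^-1` `]y - m.+1%:R^-1, +oo[%classic).
    apply: open_comp; first by move=> ? _; exact: fcont.
    exact: rray_open.
  have [|z [yz [q _ qz]]] := dense_rat _ oU.
    by exists x => /=; rewrite in_itv/= andbT.
  by exists q => //; move: yz; rewrite -qz /= in_itv/= andbT.
move=> yw; rewrite leNgt; apply/negP => sy.
have sy0 : 0 < y - supnorm (random_trig_poly xi phi n w) by rewrite subr_gt0.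
have [q _] := yw (Num.truncn (y - supnorm (random_trig_poly xi phi n w))^-1) I.
apply/negP; rewrite -leNgt lerBrDr.
apply: (@le_trans _ _ (supnorm (random_trig_poly xi phi n w) +
    (Num.truncn (y - supnorm (random_trig_poly xi phi n w))^-1).+1%:R^-1)).
  by rewrite lerD2r; apply: (ub_le_sup (fub w)); exists (ratr q).
rewrite addrC -lerBrDr invf_ple ?posrE// ltW// truncnS_gt//.
Qed.

End measurability.

Section tail_bound.
Local Open Scope ereal_scope.
Context d (T : measurableType d) (R : realType) (Q : probability T R).
Variable X : nat -> {RV Q >-> R}.

Lemma measure_bigU_le (F : nat -> set T) (N : nat) (e : R) :
  (forall k, measurable (F k)) -> (forall k, Q (F k) <= e%:E) ->
  Q (\big[setU/set0]_(k < N) F k) <= (N%:R * e)%:E.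
Proof.
move=> mF Fe; apply: (le_trans (Boole_inequality _ (fun k _ => mF k))).
apply: (@le_trans _ _ (\sum_(k < N) e%:E)).
  by apply: lee_sum => k _; exact: Fe.
by rewrite sumEFin sumr_const card_ord mulr_natl.
Qed.

Lemma supnorm_tail_le (phi : R -> R) (K dl m B t lam : R) n :
  mutually_independent X -> (0 <= K)%R -> (0 < dl)%R ->
  (forall j s, (`|s| <= dl / 2)%R -> 'M_Q (X j) s <= (expR (K * s ^+ 2))%:E) ->
  (forall j, 'M_Q (X j) dl + 'M_Q (X j) (- dl) = m%:E) ->
  (0 < n)%N -> (forall j, (j < n)%N -> (`|phi (j%:R / n%:R)| <= B)%R) ->
  (0 < t)%R -> (t * B <= dl / 2)%R -> (B * (pi *+ 2 / n%:R) < lam)%R ->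
  Q [set w | (lam *+ 4 <= supnorm (random_trig_poly X phi n w))%R] <=
  (n%:R * (m * expR (- (dl * n%:R))) + n%:R ^+ 4 *
    (4 * expR (K * (t ^+ 2 * \sum_(j < n) `|phi (j%:R / n%:R)| ^+ 2) - t * lam)))%:E.
Proof.
move=> indX K0 dl0 MX Mm n0 phiB t0 tB Blam.
have n0' : (0 < n%:R :> R)%R by rewrite ltr0n.
pose N := (n ^ 4)%N; have N0 : (0 < N)%N by rewrite expn_gt0 n0.
pose node k : R := (k%:R / N%:R * (pi *+ 2))%R.
pose ac k j := (phi (j%:R / n%:R) * cos (j%:R * node k))%R.
pose as_ k j := (phi (j%:R / n%:R) * sin (j%:R * node k))%R.
pose F j := [set w | (n%:R <= `|X j w|)%R].
pose Gc k := [set w | (lam <= `|weighted_sum X (ac k) n w|)%R].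
pose Gs k := [set w | (lam <= `|weighted_sum X (as_ k) n w|)%R].
have mge (y : R) (f : T -> R) : measurable_fun setT f ->
    measurable [set w | (y <= `|f w|)%R].
  move=> mf; rewrite -[X in measurable X]setTI.
  rewrite (_ : [set _ | _] = (fun w => `|f w|%R) @^-1` `[y, +oo[%classic).
    exact: measurableT_comp.
  by apply/seteqP; split=> w /=; rewrite in_itv/= andbT.

have mF j : measurable (F j) by apply/(mge _ (X j))/measurable_funP.
have mGc k : measurable (Gc k) by exact/mge/measurable_weighted_sum.
have mGs k : measurable (Gs k) by exact/mge/measurable_weighted_sum.
have mG k : measurable (Gc k `|` Gs k) by exact: measurableU.
set E := expR (_ - _).
have QF j : Q (F j) <= (m * expR (- (dl * n%:R)))%:E by exact: chernoff_norm.
have tphi j : (j < n)%N -> (t * `|phi (j%:R / n%:R)| <= dl / 2)%R.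
  by move=> jn; apply: le_trans tB; rewrite ler_pM2l// phiB.
have QG k : Q (Gc k `|` Gs k) <= (4 * E)%:E.
  apply: (le_trans (measureU2 _ (mGc k) (mGs k))).
  rewrite (_ : 4 * E = 2 * E + 2 * E)%R ?EFinD; last by ring.
  apply: leeD; apply: (chernoff_norm_weighted_sum _ indX K0 MX t0 _ tphi) => j _.
    by rewrite normrM ler_piMr// cos_max.
  by rewrite normrM ler_piMr// sin_max.
apply: (@le_trans _ _ (Q (\big[setU/set0]_(j < n) F j `|`
    \big[setU/set0]_(k < N) (Gc k `|` Gs k)))); last first.
  apply: (le_trans (measureU2 _ _ _)); try exact: bigsetU_measurable.
  rewrite EFinD -natrX; apply: leeD; first exact: measure_bigU_le mF QF.
  exact: measure_bigU_le mG QG.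
apply: le_measure; rewrite ?inE.
- by apply: measurable_supnorm_ge => j; exact: measurable_funP.
- by apply: measurableU; exact: bigsetU_measurable.
move=> w /=.
rewrite -(bigcup_mkord n F) -(bigcup_mkord N (fun k => Gc k `|` Gs k)).
apply: contraPP => /not_orP[nF nG].
apply/negP; rewrite -ltNge.
have XF j : (j < n)%N -> (`|X j w| < n%:R)%R.
  by move=> jn; rewrite ltNge; apply/negP => h; apply: nF; exists j.
pose c j := (X j w * phi (j%:R / n%:R))%R.
have cB : (\sum_(j < n) j%:R * `|c j| <= n%:R ^+ 3 * B)%R.
  apply: (@le_trans _ _ (\sum_(j < n) n%:R * (n%:R * B))%R).
    apply: ler_sum => j _; rewrite ler_pM// ?ler_nat ?(ltnW (ltn_ord j))//.
    by rewrite normrM ler_pM// ?phiB// ltW// XF.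
  rewrite sumr_const card_ord -mulr_natl le_eqVlt; apply/orP; left; apply/eqP.
  by ring.
have net k : (k < N)%N -> (`|cos_sum c n (node k)| <= lam)%R /\
    (`|sin_sum c n (node k)| <= lam)%R.
  have cE : cos_sum c n (node k) = weighted_sum X (ac k) n w.
    by apply: eq_bigr => j _; rewrite /c /ac -mulrA mulrC.
  have sE : sin_sum c n (node k) = weighted_sum X (as_ k) n w.
    by apply: eq_bigr => j _; rewrite /c /as_ -mulrA mulrC.
  move=> kN; split; rewrite leNgt; apply/negP => h; apply: nG; exists k => //.
    by left; rewrite /Gc/= -cE ltW.
  by right; rewrite /Gs/= -sE ltW.
apply: (le_lt_trans (supnorm_le_net N0 cB net)).
have : (n%:R ^+ 3 * B * (pi *+ 2 / N%:R) < lam)%R.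
  rewrite (_ : _ * _ = B * (pi *+ 2 / n%:R))%R//.
  move: (pi *+ 2)%R => p; rewrite /N natrX; field; exact: lt0r_neq0.
by move: (_ * _)%R => y; lra.
Qed.

End tail_bound.

Section asymptotics.
Context (R : realType).
Implicit Types (phi : R -> R) (n : nat).

Lemma bounded_on_itv01 phi : {within `[0, 1], continuous phi} ->
  exists2 B : R, 0 < B & forall x, x \in `[0, 1] -> `|phi x| <= B.
Proof.
move=> cphi; have [c _ cM] := EVT_max ler01 cphi.
have [e _ eM] := EVT_min ler01 cphi.
exists (`|phi c| + `|phi e| + 1).
  by rewrite ltr_wpDl// addr_ge0.
move=> x x01; rewrite ler_norml; have := cM x x01; have := eM x x01.
have := ler_norm (phi c); have := ler_norm (- phi e); rewrite normrN.
have := normr_ge0 (phi c); have := normr_ge0 (phi e).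
by move=> *; apply/andP; split; lra.
Qed.

Lemma sum_sqr_ge_linear phi : {within `[0, 1], continuous phi} ->
  (exists2 x : R, x \in `[0, 1] & phi x != 0) ->
  exists2 kappa : R, 0 < kappa &
    \forall n \near \oo, kappa * n%:R <= \sum_(j < n) `|phi (j%:R / n%:R)| ^+ 2.
Proof.
move=> cphi [x0 x01 phi0].
pose e := `|phi x0| / 2; have e0 : 0 < e by rewrite divr_gt0 ?normr_gt0.
have [eta /= eta0 phieta] : exists2 eta : R, 0 < eta &
    forall y, y \in `[0, 1] -> `|y - x0| < eta -> e <= `|phi y|.
  have /subspace_continuousP/(_ x0 x01)/cvgrPdist_lt/(_ _ e0) := cphi.
  rewrite near_withinE => -[eta /= eta0 H]; exists eta => // y y01 yx.
  have := H y; rewrite /= distrC => /(_ yx y01) h.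
  have : `|phi x0| <= `|phi x0 - phi y| + `|phi y|.
    by rewrite -{1}(subrK (phi y) (phi x0)) ler_normD.
  by rewrite /e in h *; lra.
move: x01; rewrite in_itv/= => /andP[x00 x01].
(* [|phi| >= e] on [[u, v]], which contains at least [(v - u) n - 2] of the
   points [j / n]. *)
pose u := Num.max 0 (x0 - eta / 2); pose v := Num.min 1 (x0 + eta / 2).
have u0 : 0 <= u by rewrite /u le_max lexx.
have v1 : v <= 1 by rewrite /v ge_min lexx.
have ux : x0 - eta / 2 <= u by rewrite /u le_max lexx orbT.
have vx : v <= x0 + eta / 2 by rewrite /v ge_min lexx orbT.
have uv : u < v.
  by rewrite /u /v lt_min !gt_max ltr01/=; apply/and3P; split; lra.
exists ((v - u) / 2 * e ^+ 2).
  by rewrite mulr_gt0 ?divr_gt0 ?subr_gt0 ?exprn_gt0.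
near=> n.
have n0 : 0 < n%:R :> R by near: n; exact: nbhs_infty_gtr.
have nuv : 4 / (v - u) <= n%:R by near: n; exact: nbhs_infty_ger.
pose a := (Num.truncn (u * n%:R)).+1; pose b := Num.truncn (v * n%:R).
have un0 : 0 <= u * n%:R by rewrite mulr_ge0// ltW.
have vn0 : 0 <= v * n%:R by rewrite mulr_ge0// ltW// (le_lt_trans u0).
have ua : u * n%:R < a%:R by exact: truncnS_gt.
have au : a%:R <= u * n%:R + 1 by rewrite -natr1 lerD2r truncn_le.
have bv : b%:R <= v * n%:R by rewrite truncn_le.
have vb : v * n%:R < b%:R + 1 by rewrite natr1 truncnS_gt.
have bn : (b <= n)%N.
  by rewrite -(ler_nat R) (le_trans bv)// ler_piMl// ltW.
clearbody a b.
have nuv' : 4 <= v * n%:R - u * n%:R.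
  by move: nuv; rewrite ler_pdivrMr ?subr_gt0// mulrC mulrBl.
have ab : (a <= b)%N.
  by rewrite -(ler_nat R); lra.
rewrite -(big_mkord xpredT (fun j => `|phi (j%:R / n%:R)| ^+ 2)).
rewrite (big_cat_nat (leq0n a) (leq_trans ab bn)).
rewrite (big_cat_nat ab bn)/= addrCA ler_wpDr//.
  by rewrite addr_ge0// sumr_ge0// => j _; rewrite sqr_ge0.
apply: (@le_trans _ _ (\sum_(a <= j < b) e ^+ 2)).
  rewrite sumr_const_nat -[leRHS]mulr_natl natrB//.
  rewrite mulrAC ler_wpM2r ?sqr_ge0//.
  by lra.
apply: ler_sum_nat => j /andP[aj jb].
have ju : u <= j%:R / n%:R.
  by rewrite ler_pdivlMr// ltW// (lt_le_trans ua)// ler_nat.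
have jv : j%:R / n%:R <= v.
  by rewrite ler_pdivrMr// (le_trans _ bv)// ler_nat ltnW.
rewrite lerXn2r ?nnegrE ?(ltW e0)// phieta//.
  by rewrite in_itv/= (le_trans u0 ju) (le_trans jv v1).
by rewrite ltr_norml; apply/andP; split; lra.
Unshelve. all: by end_near. Qed.

Lemma ln_ge_half n : (2 <= n)%N -> 2^-1 <= ln n%:R :> R.
Proof.
move=> n2; have n0 : 0 < n%:R :> R by rewrite ltr0n (leq_trans _ n2).
have i0 : 0 < n%:R^-1 :> R by rewrite invr_gt0.
have : ln n%:R^-1 <= n%:R^-1 - 1 :> R.
  have := @le_ln1Dx R (n%:R^-1 - 1); rewrite [1 + _]addrC subrK; apply.
  by lra.
rewrite lnV ?posrE//.
have : n%:R^-1 <= 2^-1 :> R by rewrite lef_pV2 ?posrE// ler_nat.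
by lra.
Qed.

Lemma chernoff_parameters (K dl m B kappa A : R) n :
  0 <= K -> 0 < dl -> 0 <= m -> 0 < B -> 0 < kappa -> (2 <= n)%N ->
  kappa * n%:R <= A -> 2 / kappa <= n%:R -> B * (pi *+ 2) <= n%:R ->
  (8 * B ^+ 2 / (kappa * dl ^+ 2)) ^+ 2 <= n%:R ->
  let t := Num.sqrt (ln n%:R / A) in
  let lam := (K + 6) * Num.sqrt (ln n%:R * A) in
  [/\ 0 < t, t * B <= dl / 2, B * (pi *+ 2 / n%:R) < lam &
    n%:R * (m * expR (- (dl * n%:R))) +
      n%:R ^+ 4 * (4 * expR (K * (t ^+ 2 * A) - t * lam)) <=
    (27 * m / dl ^+ 3 + 4) / n%:R ^+ 2].
Proof.
move=> K0 dl0 m0 B0 k0 n2 kA n2k nB n8 t lam.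
have n0 : 0 < n%:R :> R by rewrite ltr0n (leq_trans _ n2).
have l2 := ln_ge_half n2.
have l0 : 0 < ln n%:R :> R by apply: lt_le_trans l2; rewrite invr_gt0.
have A0 : 0 < A by apply: lt_le_trans kA; exact: mulr_gt0.
have t0 : 0 < t by rewrite sqrtr_gt0 divr_gt0.
have tE : t ^+ 2 * A = ln n%:R.
  by rewrite sqr_sqrtr ?divfK ?lt0r_neq0// ltW// divr_gt0.
set L := Num.sqrt (ln n%:R * A) in lam *.
have tL : t * L = ln n%:R.
  rewrite -sqrtrM; last by rewrite ltW// divr_gt0.
  rewrite mulrACA -expr2 mulVf ?lt0r_neq0// mulr1 sqrtr_sqr ger0_norm//.
  exact: ltW.
have L1 : 1 <= L.
  rewrite -(sqrtr1 R) ler_wsqrtr//.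
  move: n2k; rewrite ler_pdivrMr// => n2k.
  by nra.
split => //.
(* [ln n <= 2 sqrt n], so [ln n / A] tends to [0]. *)
- pose s := Num.sqrt (n%:R : R).
  have s0 : 0 < s by rewrite sqrtr_gt0.
  have sn : s ^+ 2 = n%:R by rewrite sqr_sqrtr// ltW.
  have ls : ln n%:R <= 2 * s.
    by rewrite -sn lnXn// -[_ *+ 2]mulr_natl ler_pM2l// ltW// ln_sublinear.
  have s8 : 8 * B ^+ 2 / (kappa * dl ^+ 2) <= s.
    rewrite -(@ler_pXn2r _ 2)// ?nnegrE ?(ltW s0)//; first by rewrite sn.
    by rewrite divr_ge0 ?mulr_ge0 ?sqr_ge0// ltW.
  rewrite -(@ler_pXn2r _ 2)// ?nnegrE.
  + rewrite exprMn sqr_sqrtr ?divr_ge0 ?(ltW l0) ?(ltW A0)//.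
    rewrite mulrAC ler_pdivrMr//.
    move: s8; rewrite ler_pdivrMr ?mulr_gt0 ?exprn_gt0// => s8.
    apply: (@le_trans _ _ (2 * s * B ^+ 2)).
      by rewrite ler_wpM2r ?sqr_ge0.
    apply: (@le_trans _ _ ((dl / 2) ^+ 2 * (kappa * n%:R))); last first.
      by rewrite ler_wpM2l ?sqr_ge0.
    rewrite -sn expr2 [s ^+ 2]expr2.
    have := ler_wpM2l (ltW s0) s8; rewrite !expr2; lra.
  + by rewrite mulr_ge0 ?(ltW t0) ?(ltW B0).
  + by rewrite divr_ge0 ?(ltW dl0).
- apply: (@le_lt_trans _ _ 1); first by rewrite mulrA ler_pdivrMr// mul1r.
  by rewrite /lam; nra.
- have tlam : t * lam = (K + 6) * ln n%:R by rewrite /lam mulrCA tL.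
  rewrite tE tlam (_ : K * _ - _ = 6%:R * - ln n%:R); last by lra.
  rewrite expRM_natl [expR (- ln _)]expRN lnK ?posrE//.
  rewrite [leRHS]mulrDl; apply: lerD; last first.
    rewrite le_eqVlt; apply/orP; left; apply/eqP; field; exact: lt0r_neq0.
  (* [exp (dl n) >= (dl n / 3)^3]: the source of the [27 m / dl^3] term. *)
  have e3 : (dl * n%:R / 3) ^+ 3 <= expR (dl * n%:R).
    pose z := dl * n%:R / 3.
    have z0 : 0 <= z by rewrite divr_ge0 ?mulr_ge0 ?(ltW dl0).
    rewrite -/z (_ : dl * n%:R = 3%:R * z); last by rewrite /z; field.
    rewrite expRM_natl lerXn2r ?nnegrE ?expR_ge0//.
    by have := expR_ge1Dx z; lra.
  have e3' : expR (- (dl * n%:R)) <= 27 / (dl ^+ 3 * n%:R ^+ 3).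
    rewrite expRN invf_ple ?posrE ?expR_gt0 ?divr_gt0 ?mulr_gt0 ?exprn_gt0//.
    apply: le_trans e3; rewrite le_eqVlt; apply/orP; left; apply/eqP; field.
    by rewrite !lt0r_neq0.
  apply: (@le_trans _ _ (n%:R * (m * (27 / (dl ^+ 3 * n%:R ^+ 3))))).
    by rewrite ler_pM2l// ler_wpM2l.
  rewrite le_eqVlt; apply/orP; left; apply/eqP; field.
  by rewrite !lt0r_neq0.
Qed.

End asymptotics.

Lemma fin_num_sum_ge0 (R : realType) (x y : \bar R) :
  (0 <= x)%E -> (0 <= y)%E -> x \is a fin_num -> y \is a fin_num ->
  exists2 m : R, 0 <= m & (x + y = m%:E)%E.
Proof.
move=> x0 y0 xf yf; exists (fine (x + y)).
  by rewrite fine_ge0// adde_ge0.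
by rewrite fineK// fin_numD xf.
Qed.

(* [C0] and [C1] are chosen from the function [M] and [phi] alone, before the
   probability spaces and the random variables. *)
Theorem theorem2p2 (R : realType) (M : R -> \bar R) (phi : R -> R)
    (phi_cont : {within `[0, 1], continuous phi})
    (phi_neq0 : exists2 x : R, x \in `[0, 1] & phi x != 0) :
  exists C0 C1 : R, [/\ 0 < C0, 0 < C1 &
    forall (d : measure_display) (T : measurableType d) (P : probability T R)
      (xi : {RV P >-> R}),
      ('E_P[xi] = 0)%E ->
      (0 < 'V_P[xi])%E -> ('V_P[xi] < +oo)%E ->
      (forall t : R, 'M_P xi t = M t) ->
      (exists a b : R, [/\ a < 0, 0 < b &
        forall t : R, t \in `]a, b[ -> 'M_P xi t \is a fin_num]) ->
    forall (d' : measure_display) (Omega : measurableType d')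
      (Q : probability Omega R) (X : nat -> {RV Q >-> R}),
      mutually_independent X ->
      (forall k : nat, equal_in_distribution (X k) xi) ->
      \forall n \near \oo,
        (Q [set w | (C0 * Num.sqrt (ln n%:R *
                       \sum_(j < n) `|phi (j%:R / n%:R)| ^+ 2) <=
                     supnorm (random_trig_poly X phi n w))%R]
         <= (C1 / n%:R ^+ 2)%:E)%E].
Proof.
have [B B0 phiB] := bounded_on_itv01 phi_cont.
have [kappa k0 Akappa] := sum_sqr_ge_linear phi_cont phi_neq0.
have [[dl [m [dl0 m0 Mm]]]|noM] := pselect (exists dl m : R,
  [/\ 0 < dl, 0 <= m & (M dl + M (- dl)%R = m%:E)%E]); last first.
  exists 1, 1; split => // d T P xi E0 V0 Voo MxiM [a [b [a0 b0 Mfin]]].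
  exfalso; apply: noM; pose c := Num.min (- a) b.
  have c0 : 0 < c by rewrite lt_min oppr_gt0 a0.
  have ca : c <= - a by rewrite ge_min lexx.
  have cb : c <= b by rewrite ge_min lexx orbT.
  pose dl := c / 2; have dl0 : 0 < dl by rewrite divr_gt0.
  have dla : dl < - a by rewrite /dl; lra.
  have dlb : dl < b by rewrite /dl; lra.
  clearbody dl.
  have [||m m0 Mm] := fin_num_sum_ge0 (mmt_gen_fun_ge0 xi dl)
    (mmt_gen_fun_ge0 xi (- dl)).
  - by apply: Mfin; rewrite in_itv/= dlb andbT; lra.
  - by apply: Mfin; rewrite in_itv/=; apply/andP; split; lra.
  by exists dl, m; rewrite -!MxiM.
pose K := 16 / dl ^+ 2 * m.
have K0 : 0 <= K by rewrite mulr_ge0 ?divr_ge0 ?sqr_ge0.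
exists (4 * (K + 6)), (27 * m / dl ^+ 3 + 4); split.
- by lra.
- by rewrite ltr_wpDl// divr_ge0 ?mulr_ge0 ?exprn_ge0// ltW.
move=> d T P xi E0 _ _ MxiM _ d' Omega Q X indX Xxi.
have MX j s : 'M_Q (X j) s = 'M_P xi s.
  exact: mmt_gen_fun_equal_in_distribution.
have MXm j : ('M_Q (X j) dl + 'M_Q (X j) (- dl)%R = m%:E)%E.
  by rewrite !MX !MxiM.
have MXK j s : `|s| <= dl / 2 -> ('M_Q (X j) s <= (expR (K * s ^+ 2))%:E)%E.
  by rewrite MX; apply: mmt_gen_fun_gauss => //; rewrite !MxiM.
near=> n.
have n2 : (2 <= n)%N by near: n; exact: nbhs_infty_ge.
have n0 : (0 < n)%N by exact: ltnW.
set A := \sum_(j < n) _.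
have Ak : kappa * n%:R <= A by rewrite /A; near: n.
have n2k : 2 / kappa <= n%:R by near: n; exact: nbhs_infty_ger.
have nB : B * (pi *+ 2) <= n%:R by near: n; exact: nbhs_infty_ger.
have n8 : (8 * B ^+ 2 / (kappa * dl ^+ 2)) ^+ 2 <= n%:R.
  by near: n; exact: nbhs_infty_ger.
have [] := chernoff_parameters K0 dl0 m0 B0 k0 n2 Ak n2k nB n8.
set t := Num.sqrt _; set L := Num.sqrt _ => t0 tB Blam num.
have -> : 4 * (K + 6) * L = (K + 6) * L *+ 4 by rewrite -[RHS]mulr_natl mulrA.
have phijB j : (j < n)%N -> `|phi (j%:R / n%:R)| <= B.
  move=> jn; apply: phiB; rewrite in_itv/= divr_ge0//=.
  by rewrite ler_pdivrMr ?ltr0n// mul1r ler_nat ltnW.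
apply: (le_trans (supnorm_tail_le indX K0 dl0 MXK MXm n0 phijB t0 tB Blam)).
by rewrite lee_fin.
Unshelve. all: by end_near. Qed.
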